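(* Let $k_1,k_2>0$, write $k=(k_1,k_2)$ and $\gamma:=k_1+k_2$, and let $D_k^W$ be the generalized Bessel function of type $B_2$ with multiplicity values $k_1$ (on the roots $\pm e_1\pm e_2$) and $k_2$ (on the roots $\pm e_1,\pm e_2$). If $\gamma>1/2$, then the generalized Bessel function of type $B_2$ admits the following Laplace-type integral representation, for $x,y\in\mathbb{R}^2$: $$D_k^W(x,y)=\int_{\mathbb{R}^2}e^{\langle x,z\rangle}H_k(y,z)\,dz,$$ where, for $y=(y_1,y_2)$ and $z=(z_1,z_2)$, $$H_k(y,z):=\frac{(2\gamma-1)c_k}{\pi}\int_{E_{y,z}}\Big((y_1^2-y_2^2)^2(1-u^2)+4y_1^2y_2^2(1-v^2)\Big)^{-\gamma+1}\Big\{(y_1^2+y_2^2-(z_1^2+z_2^2))^2-(z_1^2-z_2^2-u(y_1^2-y_2^2))^2-4(z_1z_2-vy_1y_2)^2\Big\}^{\gamma-3/2}(1-u^2)^{k_1-1}(1-v^2)^{k_2-1}\,du\,dv,$$ $$E_{y,z}:=\Big\{(u,v)\in[-1,1]^2:\ (z_1^2-z_2^2-u(y_1^2-y_2^2))^2+4(z_1z_2-vy_1y_2)^2\le (y_1^2+y_2^2-(z_1^2+z_2^2))^2\Big\},$$ and $$c_k=\frac{\Gamma(k_1+1/2)\Gamma(k_2+1/2)}{\pi\,\Gamma(k_1)\Gamma(k_2)}.$$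
   Context: $\mathbb{R}^2$ carries the standard inner product $\langle\cdot,\cdot\rangle$ and canonical basis $(e_1,e_2)$. The root system of type $B_2$ is $R=\{\pm e_1,\pm e_2,\pm e_1\pm e_2\}$, with positive system $R_+=\{e_1,e_2,e_1-e_2,e_1+e_2\}$. For $\alpha\in R$, $\sigma_\alpha(x)=x-2\frac{\langle\alpha,x\rangle}{\langle\alpha,\alpha\rangle}\alpha$. The reflection group $W=(\mathbb{Z}_2)^2\rtimes S_2$ generated by the $\sigma_\alpha$ is the group of the 8 signed permutation matrices of size 2. The multiplicity function takes the value $k_1$ on $\{\pm e_1\pm e_2\}$ and $k_2$ on $\{\pm e_1,\pm e_2\}$. Dunkl operators: for $\xi\in\mathbb{R}^2\setminus\{0\}$, $$T_\xi f(x)=\partial_\xi f(x)+\sum_{\alpha\in R_+}k(\alpha)\langle\alpha,\xi\rangle\frac{f(x)-f(\sigma_\alpha x)}{\langle\alpha,x\rangle}.$$ The Dunkl kernel $D_k(x,y)$ is the unique analytic solution of $T_\xi D_k(\cdot,y)(x)=\langle\xi,y\rangle D_k(x,y)$ for all $\xi\neq 0$, with $D_k(0,y)=1$ for all $y$. The generalized Bessel function is $$D_k^W(x,y):=\frac{1}{|W|}\sum_{w\in W}D_k(x,wy).$$ Known fact, which may be taken as given: $$D_k^W(x,y)=c_k\int_{-1}^1\int_{-1}^1\mathcal{I}_{\gamma-1/2}\left(\sqrt{\tfrac{Z_{x,y}(u,v)}{2}}\right)(1-u^2)^{k_1-1}(1-v^2)^{k_2-1}\,du\,dv,$$ where $Z_{x,y}(u,v)=(x_1^2+x_2^2)(y_1^2+y_2^2)+u(x_1^2-x_2^2)(y_1^2-y_2^2)+4vx_1x_2y_1y_2$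 and $\mathcal{I}_\nu(t)=\Gamma(\nu+1)\sum_{n\ge0}\frac{(t/2)^{2n}}{n!\,\Gamma(n+\nu+1)}$.
   Formalization: The formal theorem assumes y ≠ 0; at y = 0 the printed formula fails, since D_k^W(x,0)=1 while both bracketed bases in H_k(0,z) vanish identically, so H_k is undefined or constant in z and the integral is 0 or +∞. *)

(* Defs.v *)
From HB Require Import structures.
From mathcomp Require Import all_boot all_order all_algebra.
From mathcomp Require Import all_classical all_reals all_analysis.
From mathcomp Require Import ring lra.

Set Implicit Arguments.
Unset Strict Implicit.
Unset Printing Implicit Defensive.

Import Order.TTheory GRing.Theory Num.Theory.
Import numFieldTopology.Exports numFieldNormedType.Exports.

Local Open Scope classical_set_scope.
Local Open Scope ring_scope.

(* The plane is [R * R], which carries both the normed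
   space structure used for directional derivatives and the product
   sigma-algebra used for integration. *)

Section Plane.
Context {R : realType}.
Implicit Types x y z : R * R.

Definition dot x y : R := x.1 * y.1 + x.2 * y.2.

Definition lebesgue2 := (@lebesgue_measure R \x @lebesgue_measure R)%E.

(* [f] is near [p] the sum of an absolutely convergent double power series; the
   terms are grouped by total degree. *)
Definition analytic_at (f : R * R -> R) (p : R * R) : Prop :=
  exists a : nat -> nat -> R,
    let term (h : R * R) (n : nat) (i : 'I_n.+1) :=
      a i (n - i)%N * h.1 ^+ i * h.2 ^+ (n - i) in
    \forall h \near (0 : R * R),
      cvgn (series (fun n => \sum_(i < n.+1) `|term h n i|)) /\
      series (fun n => \sum_(i < n.+1) term h n i) @ \oo --> f (p + h).

End Plane.

Section SpecialFunctions.
Context {R : realType}.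

(* Euler's integral; only used at positive arguments. *)
Definition Gamma (s : R) : R :=
  Rintegral lebesgue_measure `]0, +oo[ (fun t => t `^ (s - 1) * expR (- t)).

Definition bessel_I (nu t : R) : R :=
  Gamma (nu + 1) *
  limn (series (fun n =>
    (t / 2) ^+ (2 * n) / (n`!%:R * Gamma (n%:R + nu + 1)))).

End SpecialFunctions.

Section DunklB2.
Context {R : realType}.
Implicit Types x y z xi alpha : R * R.

Definition pos_roots : seq (R * R) :=
  [:: (1, 0); (0, 1); (1, -1); (1, 1)].

Definition roots : seq (R * R) := pos_roots ++ map -%R pos_roots.

(* [k2] on the roots +-e1, +-e2, and [k1] on the roots +-e1+-e2, which are the
   ones without a zero coordinate. *)
Definition mult (k1 k2 : R) alpha : R :=
  if (alpha.1 == 0) || (alpha.2 == 0) then k2 else k1.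

Definition reflection alpha x : R * R :=
  x - (2 * (dot alpha x / dot alpha alpha)) *: alpha.

(* The quotient (f x - f (sigma_alpha x)) / <alpha, x>.  On the hyperplane
   <alpha, x> = 0, where division would silently return 0, it takes the value of
   its continuous extension for f of class C^1, obtained from
   sigma_alpha x = x - (2 <alpha, x> / <alpha, alpha>) alpha. *)
Definition reflection_quotient (f : R * R -> R) alpha x : R :=
  if dot alpha x == 0 then 2 / dot alpha alpha * 'D_alpha f x
  else (f x - f (reflection alpha x)) / dot alpha x.

Definition dunkl_op (k1 k2 : R) xi (f : R * R -> R) x : R :=
  'D_xi f x +
  \sum_(alpha <- pos_roots)
     mult k1 k2 alpha * dot alpha xi * reflection_quotient f alpha x.

(* By uniqueness of the solution, at most one [D] satisfies this predicate when
   [k1] and [k2] are positive. *)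
Definition is_dunkl_kernel (k1 k2 : R) (D : R * R -> R * R -> R) : Prop :=
  forall y,
    [/\ forall x, analytic_at (D^~ y) x,
        forall xi x, xi != 0 ->
          dunkl_op k1 k2 xi (D^~ y) x = dot xi y * D x y
      & D 0 y = 1].

(* The eight signed permutations of the coordinates, indexed by a swap and two
   signs; [reflection_groupP] and [signed_perm_inj] say that they are, without
   repetition, the elements of the reflection group W. *)
Definition signed_perm (w : bool * bool * bool) x : R * R :=
  let: (s, b1, b2) := w in
  ((-1) ^+ b1 * (if s then x.2 else x.1),
   (-1) ^+ b2 * (if s then x.1 else x.2)).

Inductive reflection_group : (R * R -> R * R) -> Prop :=
| reflection_group_id : reflection_group id
| reflection_group_comp alpha w : alpha \in roots -> reflection_group w ->
    reflection_group (reflection alpha \o w).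

Definition gen_bessel (D : R * R -> R * R -> R) x y : R :=
  #|{: bool * bool * bool}|%:R^-1 *
  \sum_(w : bool * bool * bool) D x (signed_perm w y).

Definition c_k (k1 k2 : R) : R :=
  Gamma (k1 + 1 / 2) * Gamma (k2 + 1 / 2) / (pi * Gamma k1 * Gamma k2).

Definition Z_xy x y (p : R * R) : R :=
  (x.1 ^+ 2 + x.2 ^+ 2) * (y.1 ^+ 2 + y.2 ^+ 2)
  + p.1 * (x.1 ^+ 2 - x.2 ^+ 2) * (y.1 ^+ 2 - y.2 ^+ 2)
  + 4 * p.2 * x.1 * x.2 * y.1 * y.2.

Definition square : set (R * R) := `[-1, 1]%classic `*` `[-1, 1]%classic.

(* The integral representation of the generalized Bessel function that is taken
   as given. *)
Definition known_bessel_formula : Prop :=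
  forall (k1 k2 : R) (D : R * R -> R * R -> R),
    0 < k1 -> 0 < k2 -> is_dunkl_kernel k1 k2 D ->
    forall x y,
      (gen_bessel D x y)%:E =
      ((c_k k1 k2)%:E *
       \int[lebesgue2]_(p in square)
         (bessel_I (k1 + k2 - 1 / 2) (Num.sqrt (Z_xy x y p / 2))
          * (1 - p.1 ^+ 2) `^ (k1 - 1) * (1 - p.2 ^+ 2) `^ (k2 - 1))%:E)%E.

Definition E_set y z : set (R * R) :=
  [set p | square p /\
    (z.1 ^+ 2 - z.2 ^+ 2 - p.1 * (y.1 ^+ 2 - y.2 ^+ 2)) ^+ 2
    + 4 * (z.1 * z.2 - p.2 * y.1 * y.2) ^+ 2
    <= (y.1 ^+ 2 + y.2 ^+ 2 - (z.1 ^+ 2 + z.2 ^+ 2)) ^+ 2].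

(* Extended-real valued: for gamma > 1/2 the integrand is nonnegative, so no
   convergence question is hidden in a default value. *)
Definition H_k (k1 k2 : R) y z : \bar R :=
  let gamma := k1 + k2 in
  (((2 * gamma - 1) * c_k k1 k2 / pi)%:E *
   \int[lebesgue2]_(p in E_set y z)
     (((y.1 ^+ 2 - y.2 ^+ 2) ^+ 2 * (1 - p.1 ^+ 2)
        + 4 * y.1 ^+ 2 * y.2 ^+ 2 * (1 - p.2 ^+ 2)) `^ (- gamma + 1)
      * ((y.1 ^+ 2 + y.2 ^+ 2 - (z.1 ^+ 2 + z.2 ^+ 2)) ^+ 2
          - (z.1 ^+ 2 - z.2 ^+ 2 - p.1 * (y.1 ^+ 2 - y.2 ^+ 2)) ^+ 2
          - 4 * (z.1 * z.2 - p.2 * y.1 * y.2) ^+ 2) `^ (gamma - 3 / 2)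
      * (1 - p.1 ^+ 2) `^ (k1 - 1) * (1 - p.2 ^+ 2) `^ (k2 - 1))%:E)%E.

Let sgE (b : bool) (a : R) : (-1) ^+ b * a = if b then - a else a.
Proof. by case: b; rewrite ?expr1 ?expr0 ?mulN1r ?mul1r. Qed.

Lemma signed_perm_inj : injective signed_perm.
Proof.
move=> [[s b1] b2] [[s' b1'] b2'] /(congr1 (fun f => f (1, 2))).
rewrite /signed_perm /= !sgE => -[].
by case: s b1 b2 s' b1' b2' => [] [] [] [] [] [] //= e1 e2; exfalso; lra.
Qed.

Let reflE (a b : R) x : reflection (a, b) x =
  (x.1 - 2 * ((a * x.1 + b * x.2) / (a * a + b * b)) * a,
   x.2 - 2 * ((a * x.1 + b * x.2) / (a * a + b * b)) * b).
Proof. by []. Qed.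

Let refl_e1 : reflection (1, 0) = signed_perm (false, true, false).
Proof. by apply/funext => x; rewrite reflE /signed_perm !sgE; congr pair; field. Qed.

Let refl_e2 : reflection (0, 1) = signed_perm (false, false, true).
Proof. by apply/funext => x; rewrite reflE /signed_perm !sgE; congr pair; field. Qed.

Let refl_sub : reflection (1, -1) = signed_perm (true, false, false).
Proof. by apply/funext => x; rewrite reflE /signed_perm !sgE; congr pair; field. Qed.

Let refl_add : reflection (1, 1) = signed_perm (true, true, true).
Proof. by apply/funext => x; rewrite reflE /signed_perm !sgE; congr pair; field. Qed.

Let reflN alpha : reflection (- alpha) = reflection alpha.
Proof.
apply/funext => x; rewrite /reflection.
have dotN z : dot (- alpha) z = - dot alpha z by rewrite /dot /=; ring.
have dotNN : dot (- alpha) (- alpha) = dot alpha alpha by rewrite /dot /=; ring.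
by rewrite dotN dotNN mulNr mulrN scalerN scaleNr opprK.
Qed.

Let refl_signed alpha : alpha \in roots ->
  exists w, reflection alpha = signed_perm w.
Proof.
have pos a : a \in pos_roots -> exists w, reflection a = signed_perm w.
  rewrite !inE => /or4P[] /eqP ->.
  - by exists (false, true, false).
  - by exists (false, false, true).
  - by exists (true, false, false).
  - by exists (true, true, true).
rewrite mem_cat => /orP[/pos//|/mapP[a /pos[w aw] ->]].
by exists w; rewrite reflN.
Qed.

Let signed_perm_comp w1 w2 :
  exists w, signed_perm w1 \o signed_perm w2 = signed_perm w.
Proof.
case: w1 w2 => [[s b1] b2] [[t c1] c2].
exists (s (+) t, b1 (+) (if s then c2 else c1), b2 (+) (if s then c1 else c2)).
apply/funext => x; rewrite /signed_perm /= ?sgE.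
by case: s t b1 b2 c1 c2 => [] [] [] [] [] [] /=; rewrite ?opprK.
Qed.

Lemma reflection_groupP (f : R * R -> R * R) :
  reflection_group f <-> exists w, f = signed_perm w.
Proof.
split=> [|[w ->]].
  elim=> [|alpha g /refl_signed[w1 ->] _ [w2 ->]].
    exists (false, false, false); apply/funext => -[u v].
    by rewrite /= !mul1r.
  exact: signed_perm_comp.
have e1R : (1, 0) \in roots by rewrite !inE eqxx.
have e2R : (0, 1) \in roots by rewrite !inE eqxx orbT.
have subR : (1, -1) \in roots by rewrite !inE eqxx !orbT.
have idG : reflection_group (signed_perm (false, false, false)).
  rewrite (_ : signed_perm _ = id); first exact: reflection_group_id.
  by apply/funext => -[u v]; rewrite /= !mul1r.
have step (b : bool) alpha g : alpha \in roots -> reflection_group g ->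
    reflection_group (if b then reflection alpha \o g else g).
  by case: b => // aR gG; apply: reflection_group_comp.
case: w => [[s b1] b2].
have := step b1 _ _ e1R (step b2 _ _ e2R (step s _ _ subR idG)).
congr reflection_group; apply/funext => x.
rewrite refl_e1 refl_e2 refl_sub.
by case: s b1 b2 => [] [] [] /=; rewrite ?expr0 ?expr1 ?mul1r ?mulN1r ?mul1r.
Qed.

End DunklB2.

(* Main.v *)
From HB Require Import structures.
Require Import Defs.
From mathcomp Require Import all_boot all_order all_algebra.
From mathcomp Require Import all_classical all_reals all_analysis.
From mathcomp Require Import measurable_realfun zify ring lra.
Set Implicit Arguments.
Unset Strict Implicit.
Unset Printing Implicit Defensive.

Import Order.TTheory GRing.Theory Num.Theory.
Import numFieldTopology.Exports numFieldNormedType.Exports.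
Local Open Scope classical_set_scope.
Local Open Scope ring_scope.

(* Write nu = gamma - 1/2.  The Bessel function I_nu(t) is nu/pi times the Laplace transform
   at (t, 0) of the density (1 - |w|^2)^(nu-1) on the unit disc: both sides have the same power
   series, because the moments of this density follow from Gaussian moments multiplied by
   Euler's integral for Gamma(nu).  For (u, v) in the open square, Z_{x,y}(u,v)/2 is a positive
   definite quadratic form in x, with matrix M say, and a linear change of variables turns the
   disc into the ellipse <z, M^-1 z> <= 1, which is the slice of E_{y,z} at (u, v).  Inserting
   this in the known double integral and exchanging the two nonnegative integrals gives the
   theorem; the boundary of the square is negligible. *)

(** * Affine change of variable on the line *)

Section AffineChange.
Context {R : realType}.
Local Notation mu := (@lebesgue_measure R).
Local Notation T1 := (measurableTypeR R).

Lemma measurable_affine (a b : R) :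
  measurable_fun [set: T1] (fun t : T1 => a * t + b : T1).
Proof. by apply: measurable_funD => //; exact: measurable_funM. Qed.

(** Uniqueness of Lebesgue measure reduces this to half-open intervals. For a < 0 the preimage is
    closed on the other side, which leaves its length unchanged. *)
Lemma lebesgue_measure_affine (a b : R) (A : set T1) : a != 0 -> measurable A ->
  (`|a|%:E * mu ((fun t : T1 => (a * t + b)%R : T1) @^-1` A) = mu A)%E.
Proof.
move=> a0 mA.
pose k : {nonneg R} := NngNum (normr_ge0 a).
pose phi : T1 -> T1 := fun t => a * t + b.
have mphi : measurable_fun setT phi by exact: measurable_affine.
have := @lebesgue_measure_unique R (mscale k (pushforward mu phi)).
move=> /(_ mphi _ _ mA) -> //.
move=> _ [[u v] _ <-].
transitivity (`|a|%:E * mu (phi @^-1` `]u, v]%classic))%E => //.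
case: (ltgtP a 0) => [a_lt0|a_gt0|a_eq0]; last by rewrite a_eq0 eqxx in a0.
- have -> : phi @^-1` `]u, v]%classic = `[(v - b) / a, (u - b) / a[%classic.
    apply/seteqP; split => t /=; rewrite !in_itv/= /phi => /andP[];
    rewrite ltr_ndivlMr// ler_ndivrMr// ltrBlDr lerBrDr mulrC => -> ->//.
  rewrite !lebesgue_measure_itv/= !lte_fin.
  rewrite ltr_nM2r ?invr_lt0// ltrD2r.
  case: ifP => uv; last by rewrite mule0.
  rewrite -!EFinB -EFinM ltr0_norm//; congr EFin; field.
  by rewrite lt_eqF.
- have -> : phi @^-1` `]u, v]%classic = `](u - b) / a, (v - b) / a]%classic.
    apply/seteqP; split => t /=; rewrite !in_itv/= /phi;
      by rewrite ltr_pdivrMr// ler_pdivlMr// ltrBlDr lerBrDr mulrC.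
  rewrite !lebesgue_measure_itv/= !lte_fin.
  rewrite ltr_pM2r ?invr_gt0// ltrD2r.
  case: ifP => uv; last by rewrite mule0.
  rewrite -!EFinB -EFinM gtr0_norm//; congr EFin; field.
  by rewrite gt_eqF.
Qed.

Lemma ge0_integral_affine (a b : R) (f : R -> \bar R) : a != 0 ->
  measurable_fun [set: R] f -> (forall t, 0 <= f t)%E ->
  (\int[mu]_t f t = `|a|%:E * \int[mu]_t f (a * t + b)%R)%E.
Proof.
move=> a0 mf f0.
pose k : {nonneg R} := NngNum (normr_ge0 a).
pose phi : T1 -> T1 := fun t => a * t + b.
have mphi : measurable_fun setT phi by exact: measurable_affine.
rewrite -[X in (_ * X)%E](@ge0_integral_pushforward _ _ _ _ _ phi mphi mu setT f)//.
rewrite -(@ge0_integral_mscale _ _ _ _ setT _ k)//.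
apply: eq_measure_integral => A mA _.
exact/esym/lebesgue_measure_affine.
Qed.

End AffineChange.

(** * Tonelli's theorem for curried integrands, and planar Lebesgue measure *)

Section Tonelli.
Local Open Scope ereal_scope.
Context {d1 d2 : measure_display} {T1 : measurableType d1} {T2 : measurableType d2}.
Context {R : realType}.
Variable m1 : {sigma_finite_measure set T1 -> \bar R}.
Variable m2 : {sigma_finite_measure set T2 -> \bar R}.
Variable f : T1 -> T2 -> \bar R.
Hypothesis mf : measurable_fun [set: T1 * T2] (fun p => f p.1 p.2).
Hypothesis f0 : forall x y, 0 <= f x y.

Lemma tonelli_swap : \int[m1]_x \int[m2]_y f x y = \int[m2]_y \int[m1]_x f x y.
Proof. exact: (fubini_tonelli (fun p => f p.1 p.2) mf (fun p => f0 p.1 p.2)). Qed.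

Lemma tonelli_measurable : measurable_fun [set: T1] (fun x => \int[m2]_y f x y).
Proof.
exact: (measurable_fun_fubini_tonelli_F (m2 := m2) (fun p => f p.1 p.2) mf
  (fun p => f0 p.1 p.2)).
Qed.

Lemma tonelli_prod : \int[(m1 \x m2)%E]_p f p.1 p.2 = \int[m1]_x \int[m2]_y f x y.
Proof. exact: (fubini_tonelli1 (fun p => f p.1 p.2) mf (fun p => f0 p.1 p.2)). Qed.

End Tonelli.

(** The measure structure and sigma-finiteness are attached to [lebesgue2] itself, so that the whole
    plane can serve as one factor in [tonelli_swap]. *)
HB.instance Definition _ (R : realType) :=
  Measure.copy (@lebesgue2 R) (@lebesgue_measure R \x @lebesgue_measure R)%E.

Lemma lebesgue2_sigma_finite (R : realType) : sigma_finite setT (@lebesgue2 R).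
Proof.
exists (fun n : nat => `[- n%:R, n%:R]%classic `*` `[- n%:R, n%:R]%classic).
  apply/esym/seteqP; split => // -[u v] _.
  exists (maxn (Num.bound `|u|) (Num.bound `|v|)) => //=.
  have bnd (t : R) n : (Num.bound `|t| <= n)%N -> t \in `[- n%:R, n%:R].
    move=> tn; rewrite in_itv/= -ler_norml.
    rewrite (le_trans (ltW (archi_boundP (normr_ge0 _))))//.
    by rewrite ler_nat.
  by split; apply: bnd; [exact: leq_maxl|exact: leq_maxr].
move=> n; split; first exact: measurableX.
pose A : set R := `[- n%:R, n%:R]%classic.
have mu_lty : (@lebesgue_measure R A < +oo)%E.
  by rewrite lebesgue_measure_itv/=; case: ifP => _; rewrite -?EFinB ltry.
by rewrite /lebesgue2 product_measure1E// lte_mul_pinfty// ge0_fin_numE.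
Qed.

HB.instance Definition _ (R : realType) :=
  Measure_isSigmaFinite.Build _ _ _ (@lebesgue2 R) (@lebesgue2_sigma_finite R).

Lemma measurable_fun_boolr {d} {T : measurableType d} {R : realType} (b : T -> bool) :
  measurable_fun [set: T] b -> measurable_fun [set: T] (fun x => (b x)%:R : R).
Proof.
move=> mb; rewrite (_ : (fun _ => _) = (\1_(b @^-1` [set true]) : T -> R)).
  by apply: measurable_indic; rewrite -[X in measurable X]setTI; exact: mb.
apply/funext => x; rewrite indicE; congr (nat_of_bool _)%:R.
by apply/idP/idP; rewrite inE.
Qed.

(** * Truncated powers, and tactics for nonnegativity and measurability *)

Section TruncatedPower.
Context {R : realType}.
Implicit Types a c t : R.

(* Unlike [powR], which returns 1 at negative arguments, [tpow] vanishes there. *)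
Definition tpow a t : R := (0 <= t)%R%:R * t `^ a.

Lemma tpow_ge0 a t : 0 <= tpow a t.
Proof. by rewrite mulr_ge0 ?powR_ge0. Qed.

Lemma tpow_lt0 a t : t < 0 -> tpow a t = 0.
Proof. by move=> t0; rewrite /tpow leNgt t0 mul0r. Qed.

Lemma tpowMl a c t : 0 < c -> tpow a (c * t) = c `^ a * tpow a t.
Proof.
move=> c0; rewrite /tpow pmulr_rge0//; have [t0|t0] := leP 0 t.
  by rewrite !mul1r powRM// ltW.
by rewrite !mul0r mulr0.
Qed.

Lemma measurable_tpow a : measurable_fun [set: R] (tpow a).
Proof.
apply: measurable_funM; last exact: measurable_powR.
by apply: measurable_fun_boolr; apply: measurable_fun_ler.
Qed.

End TruncatedPower.

Lemma expr2m_ge0 {R : realType} (w : R) m : 0 <= w ^+ (2 * m).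
Proof. by rewrite exprM exprn_ge0 ?sqr_ge0. Qed.

Ltac nonneg := rewrite ?lee_fin; repeat first
  [ assumption | exact: expr2m_ge0 | exact: sqr_ge0 | exact: tpow_ge0 | exact: powR_ge0
  | exact: expR_ge0 | exact: ler0n | exact: ltW | apply: mulr_ge0 ].

(* The head symbol is matched syntactically: trying the closure lemmas in turn by
   unification up to conversion does not terminate in practice. *)
Ltac mfun_step :=
  lazymatch goal with
  | |- measurable_fun _ (fun _ => ?c) => exact: measurable_cst
  | |- measurable_fun _ (tpow _) => exact: measurable_tpow
  | |- measurable_fun _ -%R => exact: oppr_measurable
  | |- measurable_fun _ (fun x => x) => exact: measurable_id
  | |- measurable_fun _ fst => exact: measurable_fst
  | |- measurable_fun _ snd => exact: measurable_snd
  | |- measurable_fun _ (fun x => x.1) => exact: measurable_fst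
  | |- measurable_fun _ (fun x => x.2) => exact: measurable_snd
  | |- measurable_fun _ (fun x => (_).1) => apply: (measurableT_comp measurable_fst)
  | |- measurable_fun _ (fun x => (_).2) => apply: (measurableT_comp measurable_snd)
  | |- measurable_fun _ (fun x => (_)%:E) => apply/measurable_EFinP
  | |- measurable_fun _ (fun x => (_, _)) => apply: measurable_fun_pair
  | |- measurable_fun _ (fun x => _ - _) => apply: measurable_funB
  | |- measurable_fun _ (fun x => _ + _) => apply: measurable_funD
  | |- measurable_fun _ (fun x => _ * _) => apply: measurable_funM
  | |- measurable_fun _ (fun x => - _) => apply: measurable_funN
  | |- measurable_fun _ (fun x => _ ^+ _) => apply: measurable_funX
  | |- measurable_fun _ (fun x => (nat_of_bool _)%:R) => apply: measurable_fun_boolr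
  | |- measurable_fun _ (fun x => _ && _) => apply: measurable_and
  | |- measurable_fun _ (Order.lt ?a) =>
      exact: (measurable_fun_ltr (measurable_cst a) (@measurable_id _ _ _))
  | |- measurable_fun _ (Order.le ?a) =>
      exact: (measurable_fun_ler (measurable_cst a) (@measurable_id _ _ _))
  | |- measurable_fun _ (fun x => (_ < _)) => apply: measurable_fun_ltr
  | |- measurable_fun _ (fun x => (_ <= _)) => apply: measurable_fun_ler
  | |- measurable_fun _ (fun x => expR _) =>
      apply: (measurableT_comp (@measurable_expR _))
  | |- measurable_fun _ (fun x => tpow _ _) =>
      apply: (measurableT_comp (@measurable_tpow _ _))
  | |- measurable_fun _ (fun x => _ `^ _) =>
      apply: (measurableT_comp (@measurable_powR _ _))
  end.
Ltac mfun := repeat mfun_step.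

(** * Linear change of variables in the plane *)

Section LinearChange.
Context {R : realType}.
Local Notation mu := (@lebesgue_measure R).

(** For d != 0 the map splits into two one-variable substitutions: first w_2 is changed so that the
    second argument of f becomes a variable of its own, then, after an exchange of integrals, w_1 is
    changed. The Jacobians are 1 / d and (a d - b c) / d. *)
Let linear_change_aux (a b c d : R) (f : R * R -> \bar R) :
    d != 0 -> a * d - b * c != 0 ->
    measurable_fun [set: R * R] f -> (forall z, 0 <= f z)%E ->
  (\int[lebesgue2]_z f z =
   `|a * d - b * c|%:E *
     \int[lebesgue2]_w f (a * w.1 + b * w.2, c * w.1 + d * w.2)%R)%E.
Proof.
move=> d0 D0 mf f0.
have mlin (g h : R * R -> R) : measurable_fun setT g -> measurable_fun setT h ->
  measurable_fun setT (fun w : R * R => f (g w, h w)).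
  move=> mg mh; apply: (measurableT_comp mf); exact: measurable_fun_pair.
have m1 : measurable_fun [set: R * R] (fun w : R * R =>
    f (a * w.1 + b * w.2, c * w.1 + d * w.2)).
  by apply: mlin; mfun.
rewrite [in RHS]fubini_tonelli1//.
rewrite /fubini_F/=.
have m2 : measurable_fun [set: R * R] (fun w : R * R =>
    f ((a * d - b * c) / d * w.1 + b / d * w.2, w.2)).
  by apply: mlin; mfun.
have E1 : (\int[mu]_w1 \int[mu]_w2 f (a * w1 + b * w2, c * w1 + d * w2)%R =
  \int[mu]_w1 (`|d^-1|%:E *
      \int[mu]_w2 f ((a * d - b * c) / d * w1 + b / d * w2, w2)%R))%E.
  apply: eq_integral => w1 _.
  rewrite (@ge0_integral_affine _ (d^-1) (- (c / d * w1))) ?invr_eq0//; last first.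
    exact: (measurableT_comp m1 (pair1_measurable w1)).
  congr (_ * _)%E; apply: eq_integral => w2 _; congr f.
  by congr pair; field.
rewrite E1 ge0_integralZl//; last 2 first.
  exact: (@measurable_fun_fubini_tonelli_F _ _ _ _ _ mu _ m2 (fun _ => f0 _)).
  by move=> w1 _; apply: integral_ge0.
rewrite (@tonelli_swap _ _ _ _ _ mu mu
  (fun x y => f ((a * d - b * c) / d * x + b / d * y, y)) m2 (fun _ _ => f0 _)).
rewrite fubini_tonelli2//.
rewrite muleA -EFinM.
have E2 : (\int[mu]_z2 \int[mu]_z1 f (z1, z2) =
  \int[mu]_z2 (`|(a * d - b * c) / d|%:E *
     \int[mu]_w1 f ((a * d - b * c) / d * w1 + b / d * z2, z2)%R))%E.
  apply: eq_integral => z2 _.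
  rewrite -(@ge0_integral_affine _ _ _ (fun z1 => f (z1, z2)))//.
    by rewrite mulf_neq0 ?invr_eq0.
  exact: (measurableT_comp mf (pair2_measurable z2)).
rewrite [LHS]E2 ge0_integralZl//; last 2 first.
  exact: (@measurable_fun_fubini_tonelli_G _ _ _ _ _ mu _ m2 (fun _ => f0 _)).
  by move=> w1 _; apply: integral_ge0.
by rewrite -normrM.
Qed.

Lemma ge0_integral_linear (a b c d : R) (f : R * R -> \bar R) :
    a * d - b * c != 0 ->
    measurable_fun [set: R * R] f -> (forall z, 0 <= f z)%E ->
  (\int[lebesgue2]_z f z =
   `|a * d - b * c|%:E *
     \int[lebesgue2]_w f (a * w.1 + b * w.2, c * w.1 + d * w.2)%R)%E.
Proof.
move=> D0 mf f0; have [d0|d0] := eqVneq d 0; last exact: linear_change_aux.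
(* Here [c] is nonzero, so the previous case applies after exchanging the columns, that is, the
   roles of [w.1] and [w.2]. *)
have c0 : c != 0 by apply: contraNneq D0 => c0; rewrite d0 c0 !mulr0 subr0.
have D0' : b * c - a * d != 0 by rewrite -opprB oppr_eq0.
rewrite (@linear_change_aux b a d c)// distrC; congr (_ * _)%E.
have mlin : measurable_fun [set: R * R] (fun w : R * R =>
    f (a * w.1 + b * w.2, c * w.1 + d * w.2)).
  by apply: (measurableT_comp mf); mfun.
have mlin' : measurable_fun [set: R * R] (fun w : R * R =>
    f (b * w.1 + a * w.2, d * w.1 + c * w.2)).
  by apply: (measurableT_comp mf); mfun.
rewrite fubini_tonelli1// fubini_tonelli2//.
apply: eq_integral => w1 _; apply: eq_integral => w2 _ /=.
by congr f; congr pair; rewrite addrC.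
Qed.
End LinearChange.

(** Turns a domain of integration into a 0/1 factor, so that Tonelli and the changes of variables,
    stated on whole spaces, apply. *)
Lemma integral_boolr {d} {T : measurableType d} {R : realType}
    (mu : {measure set T -> \bar R}) (D : set T) (b : T -> bool) (f : T -> R) :
  (forall x, D x <-> b x) ->
  (\int[mu]_(x in D) (f x)%:E = \int[mu]_x ((b x)%:R * f x)%:E)%E.
Proof.
move=> Db; rewrite integral_mkcond; apply: eq_integral => x _.
rewrite patchE; have [bx|bx] := boolP (b x);
  first by rewrite mem_set ?mul1r//; exact/Db.
by rewrite memNset ?mul0r// => /Db; exact/negP.
Qed.

(** * Integrals over half-lines *)

Section OneDim.
Context {R : realType}.
Local Notation mu := (@lebesgue_measure R).

(** Points are null; this discards the origin, where strict and weak cut-offs differ or a pointwise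
    identity fails. *)
Lemma eq_integral_off_point (r : R) (f g : R -> \bar R) :
  measurable_fun [set: R] f -> measurable_fun [set: R] g ->
  (forall t, t != r -> f t = g t) -> (\int[mu]_t f t = \int[mu]_t g t)%E.
Proof.
move=> mf mg fg.
have mD : measurable ([set: R] `\ r) by exact: measurableD.
rewrite -(@integral_setD1 _ f r setT)//; last exact: measurable_funS mf.
rewrite -(@integral_setD1 _ g r setT)//; last exact: measurable_funS mg.
by apply: eq_integral => t /set_mem[_ /eqP]; exact: fg.
Qed.

Lemma is_derive_cvg_at_right (F f : R -> R) (a : R) :
  (forall x, a <= x -> is_derive x 1 F (f x)) ->
  F x @[x --> a^'+] --> F a.
Proof.
move=> dF; apply: cvg_at_right_filter.
have := dF a (lexx _) => -[+ _] => /derivable1_diffP/differentiable_continuous.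
exact.
Qed.

Lemma integral_bndy_is_derive (f F : R -> R) (a l : R) :
  (forall x, a <= x -> 0 <= f x) -> (forall x, a <= x -> {for x, continuous f}) ->
  (forall x, a <= x -> is_derive x 1 F (f x)) -> F x @[x --> +oo%R] --> l ->
  (\int[mu]_t ((a <= t)%R%:R * f t)%:E = (l - F a)%:E)%E.
Proof.
move=> f0 cf dF Fl.
rewrite -(@integral_boolr _ _ _ mu `[a, +oo[%classic (fun t => a <= t) f); last first.
  by move=> x /=; rewrite in_itv/= andbT.
rewrite (@ge0_continuous_FTC2y _ f F a l)//.
- apply: continuous_in_subspaceT => x; rewrite inE/= in_itv/= andbT; exact: cf.
- by move=> x /ltW/dF[].
- exact: is_derive_cvg_at_right dF.
- by move=> x; rewrite in_itv/= andbT => /ltW ax; rewrite derive1E; have [_] := dF x ax.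
Qed.

Lemma powRN_cvgy (a : R) : 0 < a -> x `^ (- a) @[x --> +oo] --> (0 : R).
Proof.
move=> a0; apply/cvgr0Pnorm_le => e e0.
near=> x.
have x0 : 0 < x by near: x; exact: nbhs_pinfty_gt.
rewrite ger0_norm ?powR_ge0// powRN -[leRHS]invrK lef_pV2 ?posrE ?powR_gt0 ?invr_gt0//.
(* The threshold for x is the point whose a-th power is 1 / e. *)
have -> : e^-1 = (e^-1 `^ a^-1) `^ a.
  by rewrite -powRrM mulVf ?gt_eqF// powRr1// invr_ge0 ltW.
have xM : e^-1 `^ a^-1 <= x.
  by near: x; apply: nbhs_pinfty_ge; rewrite num_real.
by apply: ge0_ler_powR => //; rewrite ?nnegrE ?powR_ge0 ?ltW.
Unshelve. all: by end_near. Qed.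

(** Evaluates the integral in l that remains after the rescaling in both moment recurrences. *)
Lemma integral_powRN (a : R) : 0 < a ->
  (\int[mu]_l ((1 <= l)%R%:R * l `^ (- (a + 1)))%:E = (a^-1)%:E)%E.
Proof.
move=> a0.
have dpow (b x : R) : 1 <= x -> is_derive x 1 (@powR R ^~ b) (b * x `^ (b - 1)).
  by move=> x1; apply: is_derive1_powR; exact: (lt_le_trans ltr01 x1).
pose F : R -> R := - a^-1 \*: @powR R ^~ (- a).
have dF (x : R) : 1 <= x -> is_derive x 1 F (x `^ (- (a + 1))).
  move=> /(dpow (- a)) dx; have := is_deriveZ (- a^-1) dx.
  by rewrite /GRing.scale/= mulrA mulrNN mulVf ?gt_eqF// mul1r opprD.
have cf (x : R) : 1 <= x -> {for x, continuous (fun l : R => l `^ (- (a + 1)))}.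
  move=> /(dpow (- (a + 1)))[+ _].
  by move=> /derivable1_diffP/differentiable_continuous.
have Fy : F x @[x --> +oo] --> (0 : R).
  rewrite -(scaler0 _ (- a^-1)); apply: cvgZr; exact: powRN_cvgy.
rewrite (integral_bndy_is_derive (fun _ _ => powR_ge0 _ _) cf dF Fy) /F/=.
by rewrite powR1 sub0r scaleNr opprK /GRing.scale/= mulr1.
Qed.

(** The representation of an exponential on which both moment recurrences rest. *)
Lemma integral_expRN (t : R) : 0 < t ->
  (\int[mu]_l ((1 <= l)%R%:R * (t * expR (- (l * t))))%:E = (expR (- t))%:E)%E.
Proof.
move=> t0.
pose F : R -> R := - (expR \o ((- t) \*: id)).
have FE l : F l = - expR (- (l * t)) by rewrite /F/= mulrC -mulNr.
have dF (x : R) : is_derive x 1 F (t * expR (- (x * t))).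
  apply: is_derive_eq.
  by rewrite /= /GRing.scale/= mulr1 mulrN opprK mulrC mulNr [x * t]mulrC.
have cf (x : R) : 1 <= x -> {for x, continuous (fun l : R => t * expR (- (l * t)))}.
  move=> _; apply: cvgM; first exact: cvg_cst.
  apply: continuous_comp; last exact: continuous_expR.
  by apply: cvgN; apply: cvgM; [exact: cvg_id|exact: cvg_cst].
have Fy : F x @[x --> +oo] --> (0 : R).
  rewrite -oppr0; under eq_fun do rewrite FE; apply: cvgN.
  apply: (cvg_comp (fun l => l * t) (fun x => expR (- x))); last exact: cvgr_expR.
  by apply: gt0_cvgMly.
have f0 (x : R) : 1 <= x -> 0 <= t * expR (- (x * t)).
  by move=> x1; rewrite mulr_ge0 ?expR_ge0// ltW.
rewrite (integral_bndy_is_derive f0 cf (fun x _ => dF x) Fy).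
by rewrite FE mul1r sub0r opprK.
Qed.

End OneDim.

Lemma ge0_integralZl_real {d} {T : measurableType d} {R : realType}
    (mu : {measure set T -> \bar R}) (k : R) (f : T -> R) :
  0 <= k -> measurable_fun [set: T] f -> (forall x, 0 <= f x) ->
  (\int[mu]_x (k * f x)%:E = k%:E * \int[mu]_x (f x)%:E)%E.
Proof.
move=> k0 mf f0; under eq_integral do rewrite EFinM.
apply: ge0_integralZl_EFin => //; first by move=> x _; rewrite lee_fin.
exact/measurable_EFinP.
Qed.

(** * Euler's integral: recurrence, finiteness, positivity *)

Section GammaFunction.
Context {R : realType}.
Local Notation mu := (@lebesgue_measure R).

(** Extended-real valued, because the recurrence is obtained by Tonelli before finiteness is known,
    and finiteness is then deduced from it. *)
Definition eGamma (s : R) : \bar R :=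
  (\int[mu]_t ((0 < t)%R%:R * (t `^ (s - 1) * expR (- t)))%:E)%E.

Lemma eGamma_ge0 (s : R) : (0 <= eGamma s)%E.
Proof.
by apply: integral_ge0 => t _; rewrite lee_fin !mulr_ge0 ?powR_ge0 ?expR_ge0.
Qed.

(* Insert exp(-t) = int_1^oo t exp(-l t) dl, exchange the integrals and rescale t by l;
   no integration by parts against the singularity at 0 is needed. *)
Lemma eGamma_rec (s : R) : 0 < s -> (eGamma (s + 1) = s%:E * eGamma s)%E.
Proof.
move=> s0.
pose h (t l : R) : R :=
  (0 < t)%R%:R * t `^ s * ((1 <= l)%R%:R * expR (- (l * t))).
have mh : measurable_fun [set: R * R] (fun p => (h p.1 p.2)%:E).
  by rewrite /h; mfun.
have h0 t l : 0 <= h t l by rewrite /h !mulr_ge0 ?powR_ge0 ?expR_ge0.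
have step1 : eGamma s = (\int[mu]_t \int[mu]_l (h t l)%:E)%E.
  apply: eq_integral => t _; have [t0|t0] := ltP 0 t; last first.
    by rewrite mul0r integral0_eq// => l _; rewrite /h ltNge t0/= !mul0r.
  rewrite mul1r EFinM -integral_expRN// -ge0_integralZl_real ?powR_ge0//.
  - apply: eq_integral => l _; congr EFin; rewrite /h t0 mul1r.
    rewrite -(mulr_powRB1 (ltW t0) s0); ring.
  - by mfun.
  - by move=> l; rewrite !mulr_ge0 ?expR_ge0// ltW.
have step2 : (\int[mu]_l \int[mu]_t (h t l)%:E =
    \int[mu]_l (((1 <= l)%R%:R * l `^ (- (s + 1)))%:E * eGamma (s + 1)))%E.
  apply: eq_integral => l _; have [l1|l1] := leP 1 l; last first.
    rewrite mul0r mul0e integral0_eq// => t _.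
    by rewrite /h [1 <= l]leNgt l1 mul0r mulr0.
  have l0 : 0 < l by exact: lt_le_trans l1.
  rewrite mul1r (@ge0_integral_affine _ l^-1 0); last 3 first.
  - by rewrite gt_eqF ?invr_gt0.
  - by rewrite /h; mfun.
  - by move=> t; rewrite lee_fin.
  have l0' : 0 < l^-1 by rewrite invr_gt0.
  rewrite (gtr0_norm l0').
  rewrite -!ge0_integralZl_real ?powR_ge0 ?invr_ge0 ?(ltW l0) ?(ltW l0')//.
  - apply: eq_integral => t _; congr EFin; rewrite /h addr0 l1 mul1r addrK.
    rewrite pmulr_rgt0 ?invr_gt0//.
    have [t0|t0] := ltP 0 t; last by rewrite !mul0r !mulr0.
    rewrite powRM ?invr_ge0 ?(ltW t0) ?(ltW l0)// -powR_inv1 ?(ltW l0)//.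
    rewrite -powRrM mulN1r opprD powRD ?(gt_eqF l0) ?implybT//.
    rewrite (_ : l * (l `^ (-1) * t) = t); first by ring.
    by rewrite powR_inv1 ?(ltW l0)// mulrA divff ?gt_eqF// mul1r.
  - by mfun.
  - by move=> t; rewrite !mulr_ge0 ?powR_ge0 ?expR_ge0.
  - by rewrite /h; mfun.
rewrite step1 (@tonelli_swap _ _ _ _ _ mu mu (fun t l => (h t l)%:E) mh) ?step2//.
rewrite ge0_integralZr//; last 3 first.
- by mfun.
- by move=> l _; rewrite lee_fin mulr_ge0 ?powR_ge0.
- exact: eGamma_ge0.
by rewrite integral_powRN// muleA -EFinM divff ?gt_eqF// mul1e.
Qed.

Lemma integral_expRN_ge1 :
  (\int[mu]_t ((1 <= t)%R%:R * expR (- t))%:E = (expR (- 1))%:E)%E.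
Proof.
rewrite -(integral_expRN ltr01); apply: eq_integral => t _.
by rewrite mul1r mulr1.
Qed.

(** Shifting t by 1 bounds the integral by e times that of exp(-t) over t >= 1; as an inequality
    suffices, the endpoint needs no care. *)
Lemma eGamma1_lty : (eGamma 1 < +oo)%E.
Proof.
apply: (@le_lt_trans _ _ (expR 1 * expR (- 1))%:E); last exact: ltry.
rewrite EFinM -integral_expRN_ge1 -ge0_integralZl_real ?expR_ge0//.
- rewrite /eGamma (@ge0_integral_affine _ 1 (-1)) ?oner_eq0//; last 2 first.
  + by mfun.
  + by move=> t; rewrite lee_fin !mulr_ge0 ?powR_ge0 ?expR_ge0.
  rewrite normr1 mul1e; apply: ge0_le_integral => //.
  + by move=> t _; rewrite lee_fin !mulr_ge0 ?powR_ge0 ?expR_ge0.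
  + by mfun.
  + by mfun.
  move=> t _; rewrite lee_fin mul1r subrr powRr0 mul1r subr_gt0.
  rewrite mulrCA -expRD opprB; have [t1|t1] := ltP 1 t; first by rewrite (ltW t1) lexx.
  by rewrite mul0r mulr_ge0 ?expR_ge0.
- by mfun.
Qed.

(** The recurrence gives finiteness at positive integers. For s <= n the bound t^s <= 1 + t^n gives
    it at s + 1, and the recurrence at s, since s times +oo would be infinite. *)
Lemma eGamma_lty (s : R) : 0 < s -> (eGamma s < +oo)%E.
Proof.
move=> s0.
have nat_lty n : (eGamma n.+1%:R < +oo)%E.
  elim: n => [|n IH]; first exact: eGamma1_lty.
  by rewrite -[n.+2%:R]natr1 eGamma_rec ?ltr0n// lte_mul_pinfty ?lee_fin ?ler0n.
have [n sn] : exists n : nat, s <= n%:R.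
  by exists (Num.bound s); rewrite ltW// archi_boundP// ltW.
suff : (eGamma (s + 1) < +oo)%E.
  rewrite eGamma_rec//; have := eGamma_ge0 s; case: (eGamma s) => //=.
  + by move=> r _ _; exact: ltry.
  + by rewrite gt0_muley ?lte_fin.
apply: (@le_lt_trans _ _ (eGamma 1 + eGamma n.+1%:R)%E); last first.
  by rewrite lte_add_pinfty// eGamma1_lty.
rewrite -ge0_integralD//; last 4 first.
- by move=> t _; rewrite lee_fin !mulr_ge0 ?powR_ge0 ?expR_ge0.
- by mfun.
- by move=> t _; rewrite lee_fin !mulr_ge0 ?powR_ge0 ?expR_ge0.
- by mfun.
apply: ge0_le_integral => //.
- by move=> t _; rewrite lee_fin !mulr_ge0 ?powR_ge0 ?expR_ge0.
- by mfun.
- by apply: emeasurable_funD; mfun.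
move=> t _; rewrite -EFinD lee_fin -mulrDr -mulrDl.
have [t0|t0] := ltP 0 t; last by rewrite !mul0r.
rewrite !mul1r ler_wpM2r ?expR_ge0// addrK subrr powRr0 -natr1 addrK.
have [t1|t1] := leP t 1.
  rewrite -[leLHS]addr0 lerD ?powR_ge0//.
  by rewrite -(powRr0 t); apply: ger_powR; [rewrite t0|exact: ltW].
rewrite -[leLHS]add0r lerD//.
by apply: ler_powR => //; exact: ltW.
Qed.

(** For t >= 1 the power t^s is at least 1, so the value at s + 1 dominates the integral of exp(-t)
    over t >= 1; the recurrence carries positivity down to s. *)
Lemma eGamma_gt0 (s : R) : 0 < s -> (0 < eGamma s)%E.
Proof.
move=> s0; suff : (0 < eGamma (s + 1))%E.
  by rewrite eGamma_rec// pmule_rgt0 ?lte_fin.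
apply: (@lt_le_trans _ _ (expR (- 1))%:E); first by rewrite lte_fin expR_gt0.
rewrite -integral_expRN_ge1 /eGamma; apply: ge0_le_integral => //.
- by mfun.
- by mfun.
move=> t _; rewrite lee_fin addrK.
have [t1|t1] := leP 1 t; last by rewrite mul0r !mulr_ge0 ?powR_ge0 ?expR_ge0.
rewrite (lt_le_trans ltr01 t1) !mul1r -[leLHS]mul1r ler_wpM2r ?expR_ge0//.
by rewrite -(powRr0 t); apply: ler_powR => //; exact: ltW.
Qed.

Lemma Gamma_eGamma (s : R) : 0 < s -> ((Gamma s)%:E = eGamma s)%E.
Proof.
move=> s0; rewrite /Gamma /Rintegral.
rewrite (@integral_boolr _ _ _ mu `]0, +oo[%classic (fun t => 0 < t)); last first.
  by move=> x /=; rewrite in_itv/= andbT.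
by rewrite fineK// ge0_fin_numE ?eGamma_lty// eGamma_ge0.
Qed.

Lemma Gamma_gt0 (s : R) : 0 < s -> 0 < Gamma s.
Proof. by move=> s0; rewrite -lte_fin Gamma_eGamma// eGamma_gt0. Qed.

Lemma Gamma_rec (s : R) : 0 < s -> Gamma (s + 1) = s * Gamma s.
Proof.
move=> s0; apply: EFin_inj.
by rewrite EFinM !Gamma_eGamma ?addr_gt0// eGamma_rec.
Qed.

End GammaFunction.

(** * Gaussian moments and moments of the disc density *)

Section BallMoments.
Context {R : realType}.
Local Notation mu := (@lebesgue_measure R).

Definition gauss_moment (m : nat) : \bar R :=
  (\int[mu]_w (w ^+ (2 * m) * expR (- w ^+ 2))%:E)%E.

Lemma gauss_moment0 : gauss_moment 0 = (Num.sqrt pi)%:E.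
Proof.
rewrite -integralT_gauss; apply: eq_integral => w _.
by rewrite muln0 expr0 mul1r.
Qed.

(* Same device as for [eGamma_rec], with exp(-w^2) = int_1^oo w^2 exp(-l w^2) dl. *)
Lemma gauss_moment_rec m :
  (gauss_moment m.+1 = (m%:R + 2^-1)%:E * gauss_moment m)%E.
Proof.
have s0 : (0 : R) < m%:R + 2^-1 by rewrite ltr_wpDl ?ler0n ?invr_gt0.
pose h (w l : R) : R :=
  (w ^+ (2 * m) * w ^+ 2) * ((1 <= l)%R%:R * expR (- (l * w ^+ 2))).
have mh : measurable_fun [set: R * R] (fun p => (h p.1 p.2)%:E).
  by rewrite /h; mfun.
have h0 w l : 0 <= h w l.
  by apply: mulr_ge0; apply: mulr_ge0; rewrite ?expr2m_ge0 ?sqr_ge0 ?expR_ge0.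
have step1 : gauss_moment m = (\int[mu]_w \int[mu]_l (h w l)%:E)%E.
  (* At w = 0 the inner integral is 0 because of the factor w^2, whereas for m = 0 the left
     integrand is 1. *)
  apply: (@eq_integral_off_point _ 0).
  - by mfun.
  - by apply: (@tonelli_measurable _ _ _ _ _ mu (fun w l => (h w l)%:E)) => // *;
      rewrite lee_fin.
  move=> w w0; have w20 : 0 < w ^+ 2 by rewrite exprn_even_gt0.
  rewrite EFinM -integral_expRN// -ge0_integralZl_real ?expr2m_ge0//.
  - by apply: eq_integral => l _; congr EFin; rewrite /h; ring.
  - by mfun.
  - by move=> l; rewrite mulr_ge0// mulr_ge0 ?sqr_ge0 ?expR_ge0.
have step2 : (\int[mu]_l \int[mu]_w (h w l)%:E =
    \int[mu]_l (((1 <= l)%R%:R * l `^ (- (m%:R + 2^-1 + 1)))%:E * gauss_moment m.+1))%E.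
  apply: eq_integral => l _; have [l1|l1] := leP 1 l; last first.
    rewrite mul0r mul0e integral0_eq// => w _.
    by rewrite /h [1 <= l]leNgt l1 mul0r mulr0.
  have l0 : 0 < l by exact: lt_le_trans l1.
  (* Substituting w = q t frees the exponential of l; [qE] collects the powers of l, one [q] being
     the Jacobian. *)
  pose q := l `^ (- 2^-1); have q0 : 0 < q by exact: powR_gt0.
  have lq : l * q ^+ 2 = 1.
    rewrite -powR_mulrn ?(ltW q0)// -powRrM mulNr mulVf// powR_inv1 ?(ltW l0)//.
    by rewrite divff ?gt_eqF.
  have qE : q * (q ^+ (2 * m) * q ^+ 2) = l `^ (- (m%:R + 2^-1 + 1)).
    rewrite -exprD -exprS -powR_mulrn ?(ltW q0)// -powRrM; congr powR.
    by rewrite -addnS natrD natrM; field.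
  rewrite mul1r (@ge0_integral_affine _ q 0) ?gt_eqF//; last 2 first.
  - by rewrite /h; mfun.
  - by move=> t; rewrite lee_fin.
  rewrite gtr0_norm//.
  rewrite -!ge0_integralZl_real ?powR_ge0 ?(ltW q0)//.
  - apply: eq_integral => t _; congr EFin; rewrite /h addr0 l1 mul1r -qE.
    have -> : l * (q * t) ^+ 2 = t ^+ 2 by rewrite exprMn mulrA lq mul1r.
    by rewrite [(q * t) ^+ (2 * m)]exprMn mulnS exprD; ring.
  - by mfun.
  - by move=> t; rewrite mulr_ge0 ?expR_ge0 ?expr2m_ge0.
  - by rewrite /h; mfun.
rewrite step1 (@tonelli_swap _ _ _ _ _ mu mu (fun t l => (h t l)%:E) mh) ?step2//.
rewrite ge0_integralZr//; last 3 first.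
- by mfun.
- by move=> l _; rewrite lee_fin mulr_ge0 ?powR_ge0.
- by apply: integral_ge0 => w _; rewrite lee_fin mulr_ge0 ?expR_ge0 ?expr2m_ge0.
by rewrite integral_powRN// muleA -EFinM divff ?gt_eqF// mul1e.
Qed.

(** Induction, with (2m + 2)(2m + 1) / (4(m + 1)) = m + 1/2. The factor (2m)! will cancel against
    the power series of cosh. *)
Lemma gauss_momentE m :
  gauss_moment m = (Num.sqrt pi * ((2 * m)`!%:R / (4 ^+ m * m`!%:R)))%:E.
Proof.
elim: m => [|m IH].
  by rewrite gauss_moment0 muln0 fact0 expr0 mul1r invr1 !mulr1.
rewrite gauss_moment_rec IH -EFinM; congr EFin.
have -> : (2 * m.+1)%N = (2 * m).+2 by lia.
rewrite !factS !natrM exprS.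
rewrite -[(2 * m).+2%:R]natr1 -[(2 * m).+1%:R]natr1 -[m.+1%:R]natr1 natrM.
field.
have m1 : m%:R + 1 != 0 :> R by rewrite natr1 pnatr_eq0.
have fm : m`!%:R != 0 :> R by rewrite pnatr_eq0 -lt0n fact_gt0.
by rewrite m1 fm expf_neq0 ?pnatr_eq0.
Qed.

(** The truncation in [tpow] confines w to the unit disc, so the integral can range over the whole
    plane. *)
Definition ball_moment (nu : R) (m : nat) : \bar R :=
  (\int[@lebesgue2 R]_w
    (w.1 ^+ (2 * m) * tpow (nu - 1) (1 - (w.1 ^+ 2 + w.2 ^+ 2)))%:E)%E.

Lemma eGamma_tpow (nu : R) :
  (\int[mu]_s (tpow (nu - 1) s * expR (- s))%:E = eGamma nu)%E.
Proof.
apply: (@eq_integral_off_point _ 0); [by mfun|by mfun|] => t t0.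
by rewrite /tpow le_eqVlt eq_sym (negbTE t0)/= mulrA.
Qed.

Lemma gauss_moment_prod m :
  (\int[@lebesgue2 R]_w (w.1 ^+ (2 * m) * expR (- (w.1 ^+ 2 + w.2 ^+ 2)))%:E =
   gauss_moment m * (Num.sqrt pi)%:E)%E.
Proof.
pose h (u v : R) : R := u ^+ (2 * m) * expR (- (u ^+ 2 + v ^+ 2)).
rewrite (@tonelli_prod _ _ _ _ _ mu mu (fun u v => (h u v)%:E)); last 2 first.
- by rewrite /h; mfun.
- by move=> u v; rewrite lee_fin mulr_ge0 ?expr2m_ge0 ?expR_ge0.
rewrite /gauss_moment -ge0_integralZr//; last 2 first.
- by mfun.
- by move=> u _; rewrite lee_fin mulr_ge0 ?expr2m_ge0 ?expR_ge0.
apply: eq_integral => u _.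
rewrite -gauss_moment0 /gauss_moment -ge0_integralZl_real.
- apply: eq_integral => v _; congr EFin.
  by rewrite /h muln0 expr0 mul1r opprD expRD; ring.
- by rewrite mulr_ge0 ?expr2m_ge0 ?expR_ge0.
- by mfun.
- by move=> v; rewrite mulr_ge0 ?expr2m_ge0 ?expR_ge0.
Qed.

(* Integrate w_1^(2m) exp(-|w|^2) s^(nu-1) exp(-s) over the plane times the half-line,
   then substitute s = r - |w|^2 and rescale w by sqrt r. *)
Lemma ball_moment_Gamma (nu : R) m : 0 < nu ->
  (ball_moment nu m * eGamma (m%:R + nu + 1) =
   eGamma nu * (gauss_moment m * (Num.sqrt pi)%:E))%E.
Proof.
move=> nu0.
pose h (w : R * R) (r : R) : R :=
  w.1 ^+ (2 * m) * tpow (nu - 1) (r - (w.1 ^+ 2 + w.2 ^+ 2)) * expR (- r).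
have mh : measurable_fun [set: (R * R) * R] (fun p => (h p.1 p.2)%:E).
  by rewrite /h; mfun.
have h0 w r : (0 <= (h w r)%:E)%E.
  by nonneg.
have step1 : (\int[@lebesgue2 R]_w \int[mu]_r (h w r)%:E =
    eGamma nu * (gauss_moment m * (Num.sqrt pi)%:E))%E.
  rewrite -gauss_moment_prod -ge0_integralZl//; last 3 first.
  - by mfun.
  - by move=> w _; rewrite lee_fin mulr_ge0 ?expr2m_ge0 ?expR_ge0.
  - exact: eGamma_ge0.
  apply: eq_integral => w _; rewrite muleC -eGamma_tpow.
  rewrite -ge0_integralZl_real; last 3 first.
  - by rewrite mulr_ge0 ?expr2m_ge0 ?expR_ge0.
  - by mfun.
  - by move=> s; rewrite mulr_ge0 ?tpow_ge0 ?expR_ge0.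
  rewrite (@ge0_integral_affine _ 1 (w.1 ^+ 2 + w.2 ^+ 2)) ?oner_eq0//; last first.
    by rewrite /h; mfun.
  rewrite normr1 mul1e; apply: eq_integral => s _; congr EFin.
  by rewrite /h mul1r addrK opprD expRD; ring.
rewrite -step1.
rewrite (@tonelli_swap _ _ _ _ _ (@lebesgue2 R) mu (fun w r => (h w r)%:E) mh h0).
have bm0 : (0 <= ball_moment nu m)%E.
  by apply: integral_ge0 => w _; rewrite lee_fin mulr_ge0 ?expr2m_ge0 ?tpow_ge0.
rewrite /eGamma muleC -ge0_integralZr//; last 2 first.
- by mfun.
- by move=> r _; rewrite lee_fin !mulr_ge0 ?powR_ge0 ?expR_ge0.
apply: (@eq_integral_off_point _ 0).
- by apply: emeasurable_funM => //; mfun.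
- apply: (@tonelli_measurable _ _ _ _ _ (@lebesgue2 R) (fun r w => (h w r)%:E)) => //.
  by rewrite /h; mfun.
move=> r r0; have [{}r0|r_le0] := ltP 0 r; last first.
  have r_lt0 : r < 0 by rewrite lt_neqAle r0.
  rewrite mul0r mul0e integral0_eq// => w _; rewrite /h tpow_lt0 ?mulr0 ?mul0r//.
  by rewrite subr_lt0 (lt_le_trans r_lt0)// addr_ge0 ?sqr_ge0.
have q0 : 0 < Num.sqrt r by rewrite sqrtr_gt0.
have qq : Num.sqrt r ^+ 2 = r by rewrite sqr_sqrtr// ltW.
rewrite (@ge0_integral_linear _ (Num.sqrt r) 0 0 (Num.sqrt r)); last 3 first.
- by rewrite mulr0 subr0 -expr2 qq gt_eqF.
- by rewrite /h; mfun.
- by move=> w; exact: h0.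
rewrite mulr0 subr0 -expr2 qq gtr0_norm// mul1r.
rewrite /ball_moment -!ge0_integralZl_real.
- apply: eq_integral => w _; congr EFin; rewrite /h/= !mul0r addr0 add0r !exprMn qq.
  have -> : Num.sqrt r ^+ (2 * m) = r ^+ m by rewrite exprM qq.
  have -> : r - (r * w.1 ^+ 2 + r * w.2 ^+ 2) = r * (1 - (w.1 ^+ 2 + w.2 ^+ 2)).
    by ring.
  rewrite tpowMl//.
  rewrite addrK -(@powR_mulrn _ r m) ?ltW//.
  (* One factor r is the Jacobian, r^m comes from the moment and r^(nu - 1) from the density. *)
  have -> : r `^ (m%:R + nu) = r * (r `^ m%:R * r `^ (nu - 1)).
    by rewrite mulrCA mulr_powRB1 ?ltW// powRD// (gt_eqF r0) implybT.
  ring.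
- exact: (ltW r0).
- by rewrite /h/=; mfun.
- by move=> w; rewrite /h; nonneg.
- by nonneg.
- by mfun.
- by move=> w; nonneg.
Qed.

(** Division by a positive finite Gamma value, which also shows that the moment is finite. The two
    factors sqrt pi give pi, and Gamma(nu) = Gamma(nu + 1) / nu produces the normalization of
    [bessel_I]. *)
Lemma ball_momentE (nu : R) m : 0 < nu ->
  ball_moment nu m = (pi / nu * (Gamma (nu + 1) *
    ((2 * m)`!%:R / (4 ^+ m * m`!%:R * Gamma (m%:R + nu + 1)))))%:E.
Proof.
move=> nu0.
have s0 : 0 < m%:R + nu + 1 by rewrite addr_gt0// ltr_wpDl.
have G0 := Gamma_gt0 s0.
have := ball_moment_Gamma m nu0.
rewrite -!Gamma_eGamma// gauss_momentE -!EFinM.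
move=> /(congr1 (fun z => z * ((Gamma (m%:R + nu + 1))^-1)%:E)%E).
rewrite -muleA -!EFinM divff ?gt_eqF// mule1 => ->; congr EFin.
rewrite Gamma_rec//.
have -> : Num.sqrt pi * ((2 * m)`!%:R / (4 ^+ m * m`!%:R)) * Num.sqrt pi =
   (Num.sqrt pi ^+ 2) * ((2 * m)`!%:R / (4 ^+ m * m`!%:R)) :> R by ring.
rewrite sqr_sqrtr ?pi_ge0//.
have fm : m`!%:R != 0 :> R by rewrite pnatr_eq0 -lt0n fact_gt0.
field.
by rewrite fm expf_neq0 ?pnatr_eq0 ?gt_eqF.
Qed.

End BallMoments.

(** * The Bessel function as a Laplace transform on the disc *)

Section BesselBall.
Context {R : realType}.
Local Notation mu := (@lebesgue_measure R).
Implicit Types t x nu : R.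

(** The odd terms of the averaged exponential series [u] vanish, so these partial sums are those of
    [u] along even indices. *)
Lemma cosh_series x :
  series (fun n => x ^+ (2 * n) / (2 * n)`!%:R) n @[n --> \oo] -->
  (expR x + expR (- x)) / 2.
Proof.
pose u n := (exp_coeff x n + exp_coeff (- x) n) / 2.
have cu : series u n @[n --> \oo] --> (expR x + expR (- x)) / 2.
  have -> : series u =
      (fun n => (series (exp_coeff x) n + series (exp_coeff (- x)) n) / 2).
    by apply/funext => n; rewrite /series/= -big_split -mulr_suml.
  by apply: cvgM; [apply: cvgD|exact: cvg_cst]; exact: is_cvg_series_exp_coeff.
have -> : series (fun n => x ^+ (2 * n) / (2 * n)`!%:R) = (fun n => series u (2 * n)%N).
  apply/funext => n; rewrite /series/=; elim: n => [|n IH].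
    by rewrite muln0 !big_nil.
  rewrite big_nat_recr//= IH mulnS !addSn add0n !big_nat_recr//= -addrA; congr +%R.
  have -> : u (2 * n).+1 = 0.
    rewrite /u/exp_coeff/= exprNn -[(-1) ^+ _]signr_odd/= mul2n odd_double/= expr1.
    by rewrite mulN1r mulNr subrr mul0r.
  rewrite addr0 /u /exp_coeff/= exprNn -[(-1) ^+ _]signr_odd/= mul2n odd_double/= expr0.
  by rewrite mul1r; field; rewrite pnatr_eq0 -lt0n fact_gt0.
apply: (cvg_comp (fun n => (2 * n)%N) (series u)); last exact: cu.
apply/cvgnyPge => A; near=> n.
by rewrite (@leq_trans n) ?leq_pmull//; near: n; exact: nbhs_infty_ge.
Unshelve. all: by end_near. Qed.

Definition ball_laplace nu t : \bar R :=
  (\int[@lebesgue2 R]_w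
    (expR (t * w.1) * tpow (nu - 1) (1 - (w.1 ^+ 2 + w.2 ^+ 2)))%:E)%E.

Lemma ball_laplace_ge0 nu t : (0 <= ball_laplace nu t)%E.
Proof. by apply: integral_ge0 => w _; nonneg. Qed.

Lemma ball_laplaceN nu t : ball_laplace nu (- t) = ball_laplace nu t.
Proof.
rewrite /ball_laplace (@ge0_integral_linear _ (-1) 0 0 1); last 3 first.
- by rewrite mulr1 mul0r subr0 oppr_eq0 oner_eq0.
- by mfun.
- by move=> w; nonneg.
rewrite mulr1 mul0r subr0 normrN normr1 mul1e.
apply: eq_integral => w _ /=; congr EFin.
by rewrite !mul0r addr0 add0r mul1r mulN1r mulrNN sqrrN.
Qed.

(** By evenness in t the exponential may be replaced by cosh, whose expansion has nonnegative terms
    only, so that sum and integral can be exchanged. *)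
Lemma ball_laplace_series nu t : (ball_laplace nu t =
  \sum_(n <oo) (t ^+ (2 * n) / (2 * n)`!%:R)%:E * ball_moment nu n)%E.
Proof.
have a0 n : 0 <= t ^+ (2 * n) / (2 * n)`!%:R.
  by rewrite divr_ge0 ?expr2m_ge0.
have E n : ((t ^+ (2 * n) / (2 * n)`!%:R)%:E * ball_moment nu n =
    \int[@lebesgue2 R]_w (t ^+ (2 * n) / (2 * n)`!%:R *
      (w.1 ^+ (2 * n) * tpow (nu - 1) (1 - (w.1 ^+ 2 + w.2 ^+ 2))))%:E)%E.
  rewrite -ge0_integralZl_real//; first by mfun.
  by move=> w; nonneg.
rewrite (eq_eseriesr (fun n _ => E n)) -integral_nneseries//; last 2 first.
- by move=> n; mfun.
- by move=> n w _; rewrite lee_fin mulr_ge0//; nonneg.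
have -> : (ball_laplace nu t = 2^-1%:E * (ball_laplace nu t + ball_laplace nu (- t)))%E.
  rewrite ball_laplaceN ge0_muleDr ?ball_laplace_ge0// -ge0_muleDl ?lee_fin//.
  by rewrite -EFinD (_ : 2^-1 + 2^-1 = 1) ?mul1e//; field.
rewrite -ge0_integralD//; last 4 first.
- by move=> w _; nonneg.
- by mfun.
- by move=> w _; nonneg.
- by mfun.
rewrite -ge0_integralZl_EFin//; last 2 first.
- by move=> w _; rewrite adde_ge0//; nonneg.
- by apply: emeasurable_funD; mfun.
apply: eq_integral => w _; apply/esym/cvg_lim => //.
under eq_fun do rewrite sumEFin.
rewrite -EFinD -EFinM; apply: cvg_EFin; first exact: nearW.
set c := tpow _ _.
have -> : 2^-1 * (expR (t * w.1) * c + expR (- t * w.1) * c) =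
    (expR (t * w.1) + expR (- (t * w.1))) / 2 * c by rewrite mulNr; ring.
rewrite (_ : _ \o _ = (fun n =>
    series (fun n => (t * w.1) ^+ (2 * n) / (2 * n)`!%:R) n * c)).
  by apply: cvgM; [exact: cosh_series|exact: cvg_cst].
apply/funext => n; rewrite /series/= mulr_suml; apply: eq_bigr => i _.
by rewrite exprMn; ring.
Qed.

(** On the disc |w_1| <= 1, hence exp(t w_1) <= exp |t|, and the zeroth moment is finite. *)
Lemma ball_laplace_lty nu t : 0 < nu -> (ball_laplace nu t < +oo)%E.
Proof.
move=> nu0.
apply: (@le_lt_trans _ _ ((expR `|t|)%:E * ball_moment nu 0)%E); last first.
  by rewrite ball_momentE// -EFinM ltry.
rewrite -ge0_integralZl_real ?expR_ge0//; last 2 first.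
- by mfun.
- by move=> w; nonneg.
apply: ge0_le_integral => //.
- by move=> w _; nonneg.
- by mfun.
- by mfun.
move=> w _; rewrite lee_fin muln0 expr0 mul1r.
have [w1|w1] := leP (w.1 ^+ 2 + w.2 ^+ 2) 1; last first.
  by rewrite tpow_lt0 ?mulr0// subr_lt0.
rewrite ler_wpM2r ?tpow_ge0// ler_expR (le_trans (ler_norm _))// normrM.
rewrite ler_piMr// -(@expr_le1 _ 2)// real_normK ?num_real//.
by rewrite (le_trans _ w1)// lerDl sqr_ge0.
Qed.

Lemma bessel_I_ball nu t : 0 < nu ->
  ((bessel_I nu t)%:E = (nu / pi)%:E * ball_laplace nu t)%E.
Proof.
move=> nu0.
have pi_neq0 : (pi : R) != 0 by rewrite gt_eqF ?pi_gt0.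
have G0 : 0 < Gamma (nu + 1) by rewrite Gamma_gt0// addr_gt0.
have Gn n : 0 < Gamma (n%:R + nu + 1) by rewrite Gamma_gt0// addr_gt0// ltr_wpDl.
pose a n := (t / 2) ^+ (2 * n) / (n`!%:R * Gamma (n%:R + nu + 1)).
have a0 n : 0 <= a n by rewrite divr_ge0 ?expr2m_ge0// mulr_ge0// ltW.
pose k := pi / nu * Gamma (nu + 1).
have k0 : 0 < k by rewrite mulr_gt0// divr_gt0 ?pi_gt0.
have E : (ball_laplace nu t = k%:E * \sum_(n <oo) (a n)%:E)%E.
  rewrite ball_laplace_series -nneseriesZl; last by move=> n _; rewrite lee_fin.
  apply: eq_eseriesr => n _; rewrite ball_momentE// -!EFinM; congr EFin.
  have -> : a n = t ^+ (2 * n) / 4 ^+ n / (n`!%:R * Gamma (n%:R + nu + 1)).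
    rewrite /a expr_div_n [2 ^+ (2 * n)]exprM; congr (_ / _ ^+ _ / _); ring.
  have fact_neq0 m : m`!%:R != 0 :> R by rewrite pnatr_eq0 -lt0n fact_gt0.
  by rewrite /k; field; rewrite !fact_neq0 expf_neq0 ?pnatr_eq0// !gt_eqF.
(* Finiteness of the transform makes the Bessel series converge, so that [limn] in [bessel_I] is its
   actual sum and not a default value. *)
have S_lty : (\sum_(n <oo) (a n)%:E < +oo)%E.
  have := ball_laplace_lty t nu0; rewrite E.
  by case: (\sum_(n <oo) _)%E => [r _||]; rewrite ?ltry ?gt0_muley ?lte_fin.
have ca := nnseries_is_cvg a0 S_lty.
have S_lim : (\sum_(n <oo) (a n)%:E = (limn (series a))%:E)%E.
  apply/cvg_lim => //; under eq_fun do rewrite sumEFin.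
  by apply: cvg_EFin => //; exact: nearW.
rewrite E S_lim -!EFinM; congr EFin.
by rewrite /bessel_I -/a /k !mulrA divfK// divff ?mul1r ?gt_eqF.
Qed.

End BesselBall.

(** * From the disc to an ellipse *)

Section Ellipse.
Context {R : realType}.
Implicit Types x z : R * R.

Lemma neq0_coord x : x != 0 -> (x.1 != 0) || (x.2 != 0).
Proof.
apply: contraR; rewrite negb_or !negbK => /andP[/eqP x1 /eqP x2].
by rewrite [x]surjective_pairing x1 x2.
Qed.

(* With M the matrix of the m_ij, x = rho n, N = <n, M n> and n' = (- n_2, n_1), the map
   z = (w_1 M n + w_2 sqrt D n') / sqrt N has determinant sqrt D; it carries the unit disc
   to the ellipse and makes <x, z> depend on w_1 only. *)
Lemma ellipse_laplace (nu m11 m12 m22 : R) x :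
  let D := m11 * m22 - m12 ^+ 2 in
  0 < m11 -> 0 < D ->
  (\int[@lebesgue2 R]_z (expR (dot x z) * tpow (nu - 1)
      (D - (m22 * z.1 ^+ 2 - 2 * m12 * z.1 * z.2 + m11 * z.2 ^+ 2)))%:E =
   (D `^ (nu - 2^-1))%:E * ball_laplace nu
     (Num.sqrt (m11 * x.1 ^+ 2 + 2 * m12 * x.1 * x.2 + m22 * x.2 ^+ 2)))%E.
Proof.
move=> D m11_gt0 D0.
(* For x = 0 any nonzero direction will do, with [rho] = 0; one change of variables then serves for
   all x. *)
have [n [rho [xE n0 rho0]]] : exists n (rho : R),
    [/\ x = (rho * n.1, rho * n.2), (n.1 != 0) || (n.2 != 0) & 0 <= rho].
  have [x0|x0] := eqVneq x 0.
    by exists (1, 0), 0; rewrite x0 /= !mul0r oner_eq0.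
  by exists x, 1; rewrite !mul1r -surjective_pairing neq0_coord.
pose N := m11 * n.1 ^+ 2 + 2 * m12 * n.1 * n.2 + m22 * n.2 ^+ 2.
have N0 : 0 < N.
  rewrite -(pmulr_rgt0 _ m11_gt0).
  have -> : m11 * N = (m11 * n.1 + m12 * n.2) ^+ 2 + D * n.2 ^+ 2.
    by rewrite /N /D; ring.
  have [n2|n2] := eqVneq n.2 0.
    move: n0; rewrite n2 eqxx orbF => n1.
    rewrite mulr0 addr0 expr0n/= mulr0 addr0 exprn_even_gt0//=.
    by rewrite mulf_neq0// gt_eqF.
  by rewrite ltr_wpDl ?sqr_ge0// mulr_gt0// exprn_even_gt0.
pose r := Num.sqrt N; pose s := Num.sqrt D.
have r0 : 0 < r by rewrite sqrtr_gt0.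
have s0 : 0 < s by rewrite sqrtr_gt0.
have rr : r ^+ 2 = N by rewrite sqr_sqrtr// ltW.
have ss : s ^+ 2 = D by rewrite sqr_sqrtr// ltW.
have r_neq0 : r != 0 by rewrite gt_eqF.
pose P1 := m11 * n.1 + m12 * n.2; pose P2 := m12 * n.1 + m22 * n.2.
have det : P1 / r * (s * n.1 / r) - (- (s * n.2 / r)) * (P2 / r) = s.
  have -> : P1 / r * (s * n.1 / r) - (- (s * n.2 / r)) * (P2 / r) = s * N / r ^+ 2.
    by rewrite /N /P1 /P2; field.
  by rewrite rr mulfK// gt_eqF.
have -> : Num.sqrt (m11 * x.1 ^+ 2 + 2 * m12 * x.1 * x.2 + m22 * x.2 ^+ 2) = rho * r.
  rewrite xE /= (_ : _ + _ = rho ^+ 2 * N); last by rewrite /N; ring.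
  by rewrite sqrtrM ?sqr_ge0// sqrtr_sqr ger0_norm.
rewrite (@ge0_integral_linear _ (P1 / r) (- (s * n.2 / r)) (P2 / r) (s * n.1 / r));
  last 3 first.
- by rewrite det gt_eqF.
- by rewrite /dot; mfun.
- by move=> z; nonneg.
rewrite det (gtr0_norm s0).
(* The factor [s] is the Jacobian, and D^(nu - 1) comes from the homogeneity of [tpow]. *)
have -> : D `^ (nu - 2^-1) = s * D `^ (nu - 1).
  rewrite /s -powR12_sqrt ?(ltW D0)// -powRD ?(gt_eqF D0) ?implybT//.
  by congr powR; field.
rewrite EFinM -muleA; congr (_ * _)%E.
rewrite /ball_laplace -ge0_integralZl_real; last 3 first.
- exact: powR_ge0.
- by mfun.
- by move=> z; nonneg.
apply: eq_integral => w _; congr EFin; rewrite /dot xE /=.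
set z1 := P1 / r * w.1 + _; set z2 := P2 / r * w.1 + _.
have -> : rho * n.1 * z1 + rho * n.2 * z2 = rho * r * w.1.
  have -> : rho * n.1 * z1 + rho * n.2 * z2 = rho * (N / r) * w.1.
    by rewrite /z1 /z2 /N /P1 /P2; field.
  by rewrite -rr expr2 mulfK.
have -> : D - (m22 * z1 ^+ 2 - 2 * m12 * z1 * z2 + m11 * z2 ^+ 2) =
   D * (1 - (w.1 ^+ 2 + w.2 ^+ 2)).
  rewrite mulrBr mulr1; congr (_ - _).
  have -> : m22 * z1 ^+ 2 - 2 * m12 * z1 * z2 + m11 * z2 ^+ 2 =
     N / r ^+ 2 * (D * w.1 ^+ 2 + s ^+ 2 * w.2 ^+ 2).
    by rewrite /z1 /z2 /N /P1 /P2 /D; field.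
  by rewrite rr ss divff ?gt_eqF// mul1r mulrDr.
by rewrite tpowMl//; ring.
Qed.

End Ellipse.

(** * The ellipses attached to points of the open square *)

Section Representation.
Context {R : realType}.
Implicit Types x y z p : R * R.

(* For M = [[|y|^2 + u d, 2 v y_1 y_2], [2 v y_1 y_2, |y|^2 - u d]] / 2 with
   d = y_1^2 - y_2^2 and p = (u, v), one has <x, M x> = Z_{x,y}(u,v) / 2,
   ellipse_det = 4 det M and ellipse_form = 4 det M (1 - <z, M^-1 z>). *)
Definition ellipse_det y p : R :=
  (y.1 ^+ 2 - y.2 ^+ 2) ^+ 2 * (1 - p.1 ^+ 2)
  + 4 * y.1 ^+ 2 * y.2 ^+ 2 * (1 - p.2 ^+ 2).

Definition ellipse_form y z p : R :=
  (y.1 ^+ 2 + y.2 ^+ 2 - (z.1 ^+ 2 + z.2 ^+ 2)) ^+ 2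
  - (z.1 ^+ 2 - z.2 ^+ 2 - p.1 * (y.1 ^+ 2 - y.2 ^+ 2)) ^+ 2
  - 4 * (z.1 * z.2 - p.2 * y.1 * y.2) ^+ 2.

(** Both summands are nonnegative. The second is positive when both coordinates of y are nonzero,
    the first when exactly one is. *)
Lemma ellipse_det_gt0 y p : y != 0 -> `|p.1| < 1 -> `|p.2| < 1 ->
  0 < ellipse_det y p.
Proof.
move=> y0; rewrite -![`|_| < 1](@expr_lt1 _ 2)// !real_normK ?num_real// => p1 p2.
rewrite /ellipse_det; have [y2|y2] := eqVneq y.2 0.
  have := neq0_coord y0; rewrite y2 eqxx orbF => y1.
  rewrite expr0n/= mulr0 mul0r addr0 subr0 mulr_gt0 ?subr_gt0//.
  by rewrite exprn_even_gt0//= expf_neq0.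
have [y1|y1] := eqVneq y.1 0.
  rewrite y1 expr0n/= mulr0 !mul0r addr0 sub0r sqrrN mulr_gt0 ?subr_gt0//.
  by rewrite exprn_even_gt0//= expf_neq0.
rewrite ltr_wpDl//; first by apply: mulr_ge0; rewrite ?sqr_ge0 ?subr_ge0 ?ltW.
by rewrite mulr_gt0 ?subr_gt0// mulr_gt0 ?exprn_even_gt0// mulr_gt0 ?exprn_even_gt0.
Qed.

(** This is [ellipse_laplace] with D = [ellipse_det] / 4. The powers of [ellipse_det] cancel, and
    those of 4 leave 4^(-1/2) = 1/2. With nu = gamma - 1/2 the exponents are the two in [H_k]. *)
Lemma ellipse_form_laplace (nu : R) x y p :
  y != 0 -> `|p.1| < 1 -> `|p.2| < 1 ->
  ((ellipse_det y p `^ (2^-1 - nu))%:E * \int[@lebesgue2 R]_z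
      (expR (dot x z) * tpow (nu - 1) (ellipse_form y z p))%:E =
   2^-1%:E * ball_laplace nu (Num.sqrt (Z_xy x y p / 2)))%E.
Proof.
move=> y0 p1 p2; have Delta0 := ellipse_det_gt0 y0 p1 p2.
pose m11 := (y.1 ^+ 2 + y.2 ^+ 2 + p.1 * (y.1 ^+ 2 - y.2 ^+ 2)) / 2.
pose m12 := p.2 * y.1 * y.2.
pose m22 := (y.1 ^+ 2 + y.2 ^+ 2 - p.1 * (y.1 ^+ 2 - y.2 ^+ 2)) / 2.
have DE : m11 * m22 - m12 ^+ 2 = ellipse_det y p / 4.
  by rewrite /m11 /m22 /m12 /ellipse_det; field.
have D0 : 0 < m11 * m22 - m12 ^+ 2 by rewrite DE divr_gt0.
have m11_gt0 : 0 < m11.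
  rewrite /m11 (_ : _ + _ = y.1 ^+ 2 * (1 + p.1) + y.2 ^+ 2 * (1 - p.1)); last by ring.
  move: p1; rewrite ltr_norml => /andP[u1 u2].
  have a : 0 < 1 + p.1 by lra.
  have b : 0 < 1 - p.1 by lra.
  have a1 := mulr_ge0 (sqr_ge0 y.1) (ltW a).
  have b1 := mulr_ge0 (sqr_ge0 y.2) (ltW b).
  rewrite divr_gt0//; case/orP: (neq0_coord y0) => yn.
    by rewrite ltr_wpDr// mulr_gt0// exprn_even_gt0.
  by rewrite ltr_wpDl// mulr_gt0// exprn_even_gt0.
have -> : Z_xy x y p / 2 = m11 * x.1 ^+ 2 + 2 * m12 * x.1 * x.2 + m22 * x.2 ^+ 2.
  by rewrite /Z_xy /m11 /m12 /m22; field.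
have := ellipse_laplace nu x m11_gt0 D0.
set B := ball_laplace _ _ => lap.
have -> : (\int[@lebesgue2 R]_z
     (expR (dot x z) * tpow (nu - 1) (ellipse_form y z p))%:E =
   (4 `^ (nu - 1))%:E * ((m11 * m22 - m12 ^+ 2) `^ (nu - 2^-1) )%:E * B)%E.
  rewrite -muleA -lap -ge0_integralZl_real.
  - apply: eq_integral => z _; congr EFin.
    rewrite [RHS]mulrCA -tpowMl//; congr (_ * tpow _ _).
    by rewrite /ellipse_form /m11 /m12 /m22; field.
  - exact: powR_ge0.
  - by rewrite /dot; mfun.
  - by move=> z; nonneg.
rewrite -EFinM muleA -EFinM; congr (_%:E * _)%E.
rewrite DE powRM ?invr_ge0 ?(ltW Delta0)//.
have -> : ellipse_det y p `^ (2^-1 - nu) * (4 `^ (nu - 1) *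
   (ellipse_det y p `^ (nu - 2^-1) * 4^-1 `^ (nu - 2^-1))) =
  (ellipse_det y p `^ (2^-1 - nu) * ellipse_det y p `^ (nu - 2^-1)) *
  (4 `^ (nu - 1) * 4^-1 `^ (nu - 2^-1)) by ring.
rewrite -powRD ?(gt_eqF Delta0) ?implybT// addrA subrK subrr powRr0 mul1r.
have four_neq0 : (4 : R) != 0 by rewrite pnatr_eq0.
rewrite -powR_inv1// -powRrM -powRD ?four_neq0 ?implybT//.
rewrite (_ : _ + _ = - 2^-1); last by field.
rewrite powRN powR12_sqrt// (_ : 4 = 2 ^+ 2); last by ring.
by rewrite sqrtr_sqr ger0_norm.
Qed.

End Representation.

(** * Measurability, and the null boundary of the square *)

Section Square.
Context {R : realType}.
Local Notation mu := (@lebesgue_measure R).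
Local Notation T1 := (measurableTypeR R).
Implicit Types x y z p : R * R.

Definition in_square p : bool :=
  [&& -1 <= p.1, p.1 <= 1, -1 <= p.2 & p.2 <= 1].

Lemma in_squareP p : square p <-> in_square p.
Proof.
rewrite /square /in_square; split=> [[/=]|/and4P[a b c d]].
  by rewrite !in_itv/= => /andP[-> ->] /andP[-> ->].
by split; rewrite /= in_itv/=; apply/andP.
Qed.

Lemma measurable_in_square : measurable_fun [set: R * R] in_square.
Proof. by rewrite /in_square; mfun. Qed.

Lemma measurable_ball_laplace (nu : R) : measurable_fun [set: R] (ball_laplace nu).
Proof.
pose f (t : T1) (w : T1 * T1) : \bar R :=
  (expR (t * w.1) * tpow (nu - 1) (1 - (w.1 ^+ 2 + w.2 ^+ 2)))%:E.
have mf : measurable_fun setT (fun p : T1 * (T1 * T1) => f p.1 p.2).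
  by rewrite /f; mfun.
have f0 t w : (0 <= f t w)%E by rewrite /f; nonneg.
have := @tonelli_measurable _ _ _ _ _ (@lebesgue2 R) f mf f0.
exact.
Qed.

(** Measurability is inherited from the parametric integral [ball_laplace], not derived from the
    series. *)
Lemma measurable_bessel_I (nu : R) : 0 < nu ->
  measurable_fun [set: R] (bessel_I nu).
Proof.
move=> nu0; apply/measurable_EFinP.
rewrite (_ : _ \o _ = (fun t => (nu / pi)%:E * ball_laplace nu t)%E).
  by apply: emeasurable_funM => //; exact: measurable_ball_laplace.
by apply/funext => t /=; exact: bessel_I_ball.
Qed.

Lemma bessel_I_ge0 (nu t : R) : 0 < nu -> 0 <= bessel_I nu t.
Proof.
move=> nu0; rewrite -lee_fin bessel_I_ball// mule_ge0 ?ball_laplace_ge0//.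
by rewrite lee_fin divr_ge0 ?pi_ge0// ltW.
Qed.

(** The boundary lies on four null lines. It has to be avoided because [ellipse_det] can vanish
    there. *)
Lemma ae_square_interior : \forall p \ae @lebesgue2 R,
  in_square p -> `|p.1| < 1 /\ `|p.2| < 1.
Proof.
pose A : set R := [set 1] `|` [set -1].
have mA : measurable A by exact: measurableU.
have A0 : mu A = 0%E by rewrite measureU0//; exact: lebesgue_measure_set1.
have mAT : measurable (A `*` [set: R]) by exact: measurableX.
have mTA : measurable ([set: R] `*` A) by exact: measurableX.
have AT0 : @lebesgue2 R (A `*` setT) = 0%E.
  by transitivity (mu A * mu setT)%E; [exact: product_measure1E|rewrite A0 mul0e].
have TA0 : @lebesgue2 R (setT `*` A) = 0%E.
  by transitivity (mu setT * mu A)%E; [exact: product_measure1E|rewrite A0 mule0].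
exists ((A `*` setT) `|` (setT `*` A)); split.
- exact: measurableU.
- by rewrite measureU0.
move=> p /=; apply: contra_notP => pA /and4P[a b c d].
rewrite !ltr_norml !lt_neqAle a b c d !andbT.
by split; apply/andP; split; apply/eqP => e; apply: pA; rewrite /A/=;
  have := esym e; tauto.
Qed.

End Square.

Theorem theorem1 (R : realType) (known : @known_bessel_formula R)
  (k1 k2 : R) (hk1 : 0 < k1) (hk2 : 0 < k2) (hgamma : 1 / 2 < k1 + k2)
  (D : R * R -> R * R -> R) (hD : is_dunkl_kernel k1 k2 D)
  (x y : R * R) (hy : y != 0) :
  (gen_bessel D x y)%:E =
  (\int[lebesgue2]_z ((expR (dot x z))%:E * H_k k1 k2 y z))%E.
Proof.
rewrite (known _ _ _ hk1 hk2 hD).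
pose nu := k1 + k2 - 1 / 2.
have nu0 : 0 < nu by rewrite subr_gt0.
have G_ge0 s : 0 <= Gamma s :> R.
  by apply: fine_ge0; apply: integral_ge0 => t _; nonneg.
have ck0 : 0 <= c_k k1 k2.
  by rewrite divr_ge0 ?mulr_ge0 ?pi_ge0.
pose w p : R := (1 - p.1 ^+ 2) `^ (k1 - 1) * (1 - p.2 ^+ 2) `^ (k2 - 1).
have w0 p : 0 <= w p by rewrite /w; nonneg.
pose C := (2 * (k1 + k2) - 1) * c_k k1 k2 / pi.
have C0 : 0 <= C.
  rewrite divr_ge0 ?pi_ge0// mulr_ge0//; move: nu0; rewrite /nu; lra.
(* The joint integrand on the whole product space: [in_square] and the truncation in [tpow] together
   encode [E_set]. *)
pose f z p := C * ((in_square p)%:R * (ellipse_det y p `^ (2^-1 - nu) * w p)) *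
  (expR (dot x z) * tpow (nu - 1) (ellipse_form y z p)).
have f0 z p : (0 <= (f z p)%:E)%E by rewrite /f /w; nonneg.
have mf : measurable_fun [set: (R * R) * (R * R)] (fun q => (f q.1 q.2)%:E).
  rewrite /f /w /dot /ellipse_det /ellipse_form; mfun.
  exact: (measurableT_comp measurable_in_square measurable_snd).
have mB : measurable_fun [set: R * R]
    (fun p => bessel_I (k1 + k2 - 1 / 2) (Num.sqrt (Z_xy x y p / 2))).
  apply: (measurableT_comp (measurable_bessel_I nu0)).
  apply: (measurableT_comp (continuous_measurable_fun (@sqrt_continuous R))).
  by rewrite /Z_xy; mfun.
transitivity (\int[@lebesgue2 R]_z \int[@lebesgue2 R]_p (f z p)%:E)%E; last first.
  apply: eq_integral => z _; rewrite /H_k.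
  rewrite (@integral_boolr _ _ _ (@lebesgue2 R) (E_set y z)
    (fun p => in_square p && (0 <= ellipse_form y z p))); last first.
    move=> p; rewrite /E_set/= /ellipse_form; split.
      by move=> [sq ?]; apply/andP; split; [exact/in_squareP|lra].
    by move=> /andP[sq ?]; split; [exact/in_squareP|lra].
  rewrite -ge0_integralZl_real; last 3 first.
  - exact: C0.
  - by rewrite /ellipse_form; mfun; exact: measurable_in_square.
  - by move=> p; nonneg.
  rewrite -ge0_integralZl_real; last 3 first.
  - exact: expR_ge0.
  - by rewrite /ellipse_form; mfun; exact: measurable_in_square.
  - by move=> p; nonneg.
  apply: eq_integral => p _; congr EFin.
  rewrite /f /tpow /w /ellipse_det -/(ellipse_form y z p) -/C.
  have -> : - (k1 + k2) + 1 = 2^-1 - nu by rewrite /nu; field.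
  have -> : k1 + k2 - 3 / 2 = nu - 1 by rewrite /nu; field.
  rewrite -mulnb natrM; ring.
rewrite (@tonelli_swap _ _ _ _ _ (@lebesgue2 R) (@lebesgue2 R)
  (fun z p => (f z p)%:E) mf f0).
rewrite (@integral_boolr _ _ _ (@lebesgue2 R) square in_square); last exact: in_squareP.
rewrite -ge0_integralZl_real; last 3 first.
- exact: ck0.
- by mfun; [exact: measurable_in_square|exact: mB].
- move=> p; rewrite mulr_ge0// mulr_ge0 ?powR_ge0// mulr_ge0 ?powR_ge0//.
  exact: bessel_I_ge0.
(* It remains to compare, for almost every p, the weighted Bessel integrand with the integral of [f]
   over z. *)
apply: ge0_ae_eq_integral => //.
- by mfun; [exact: measurable_in_square|exact: mB].
- apply: (@tonelli_measurable _ _ _ _ _ (@lebesgue2 R) (fun p z => (f z p)%:E)) => //.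
  rewrite /f /w /dot /ellipse_det /ellipse_form; mfun.
  exact: (measurableT_comp measurable_in_square measurable_fst).
- move=> p _; rewrite lee_fin mulr_ge0// mulr_ge0// mulr_ge0 ?powR_ge0//.
  by rewrite mulr_ge0 ?powR_ge0// bessel_I_ge0.
- by move=> p _; apply: integral_ge0.
case: (@ae_square_interior R) => N [mN N0 sN]; exists N; split => //.
apply: subset_trans sN => p /=; apply: contra_not => p_int _.
have [p_sq|p_sq] := boolP (in_square p); last first.
  rewrite mul0r mulr0 integral0_eq// => z _.
  by rewrite /f (negbTE p_sq) mul0r mulr0 mul0r.
have [p1 p2] := p_int p_sq.
under eq_integral do rewrite /f p_sq mul1r.
rewrite ge0_integralZl_real; last 3 first.
- by rewrite /w; nonneg.
- by rewrite /dot /ellipse_form; mfun.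
- by move=> z; nonneg.
have -> : C * (ellipse_det y p `^ (2^-1 - nu) * w p) =
    C * w p * ellipse_det y p `^ (2^-1 - nu) by ring.
rewrite [in RHS]EFinM -[RHS]muleA ellipse_form_laplace// [true%:R * _]mul1r.
rewrite -[_ * _ * _]mulrA -/(w p) -/nu [_ * w p]mulrC mulrA EFinM bessel_I_ball//.
rewrite !muleA -!EFinM; congr (_%:E * _)%E.
(* The constants agree because 2 gamma - 1 = 2 nu, against the factor 1/2; the inverse of pi is
   treated as an atom. *)
by rewrite /C /nu; move: (pi^-1) => q; field.
Qed.
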